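(* Let $X$ be a finite-dimensional real Hilbert space, let $A:X\rightrightarrows X$ and $B:X\rightrightarrows X$ be maximally monotone, and set $D:=\operatorname{dom}A-\operatorname{dom}B$ and $R:=\operatorname{ran}A+\operatorname{ran}B$. Let $T_{(A,B)}$ be the Douglas--Rachford operator of $(A,B)$. Suppose that $A$ and $B$ satisfy one of the following: (i) for every $w\in \operatorname{ri}D\cap\operatorname{ri}R$, $\operatorname{ri}(\operatorname{ran}A+\operatorname{ran}B)\subseteq \operatorname{ri}\operatorname{ran}(A+B_w)$, where $B_w:x\mapsto B(x-w)$; (ii) $A$ and $B$ are $3^*$ monotone; (iii) $\operatorname{dom}B+(\operatorname{ri}D\cap\operatorname{ri}R)\subseteq\operatorname{dom}A$ and $A$ is $3^*$ monotone. Then $$\operatorname{ran}(\mathrm{Id}-T_{(A,B)})\simeq D\cap R.$$ Furthermore, the following implications hold: (a) if there exists $C\in\{A,B\}$ such that $\operatorname{dom}C=X$ and $C$ is $3^*$ monotone, then $\operatorname{ran}(\mathrm{Id}-T_{(A,B)})\simeq R$; (b) if there exists $C\in\{A,B\}$ such that $\operatorname{ran}C=X$ and $C$ is $3^*$ monotone, then $\operatorname{ran}(\mathrm{Id}-T_{(A,B)})\simeq D$; (c) if $\operatorname{ri}(D\cap R)=D\cap R$, then $\operatorname{ran}(\mathrm{Id}-T_{(A,B)})=D\cap R$.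
   Context: For a maximally monotone operator $A$ on $X$, the resolvent is $J_A=(\mathrm{Id}+A)^{-1}$ (single-valued with full domain) and the reflected resolvent is $R_A=2J_A-\mathrm{Id}$. The Douglas--Rachford operator of the ordered pair $(A,B)$ is $T_{(A,B)}:=\tfrac12\mathrm{Id}+\tfrac12R_BR_A=\mathrm{Id}-J_A+J_BR_A$. A monotone operator $A:X\rightrightarrows X$ is $3^*$ monotone (rectangular) if for all $x\in\operatorname{dom}A$ and $v\in\operatorname{ran}A$, $\inf_{(z,w)\in\operatorname{gra}A}\langle x-z,v-w\rangle>-\infty$. For $S\subseteq X$, $\operatorname{ri}S$ is the interior of $S$ relative to its affine hull. Near equality of two subsets $S_1,S_2$ of $X$: $S_1\simeq S_2$ means $\overline{S_1}=\overline{S_2}$ and $\operatorname{ri}S_1=\operatorname{ri}S_2$. Sums and differences of sets are Minkowski sums and differences. *)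

(* Defs.v *)
From HB Require Import structures.
From mathcomp Require Import all_boot all_order all_algebra.
From mathcomp Require Import all_classical all_reals all_analysis.

Set Implicit Arguments.
Unset Strict Implicit.
Unset Printing Implicit Defensive.

Import Order.TTheory GRing.Theory Num.Theory.
Import numFieldNormedType.Exports.

Local Open Scope classical_set_scope.
Local Open Scope ring_scope.

(* [Vector] carries finite-dimensionality (completeness is then automatic);
   the topology of the normed module is the one induced by [inner]. *)
HB.mixin Record NormedVector_isEuclidean (R : realType) V
    & NormedModule R V & Vector R V := {
  inner : {dot V for @idfun R};
  normr_inner : forall x : V, `|x| ^+ 2 = inner x x
}.

#[short(type="euclideanType")]
HB.structure Definition Euclidean (R : realType) :=
  {V of NormedModule R V & Vector R V & NormedVector_isEuclidean R V}.

Arguments inner {R s}.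

Section Sets.
Context {R : realType} {X : euclideanType R}.
Implicit Types S : set X.

Definition set_add S1 S2 : set X := [set x + y | x in S1 & y in S2].
Definition set_sub S1 S2 : set X := [set x - y | x in S1 & y in S2].

Definition affine_set S : Prop :=
  forall (x y : X) (t : R), S x -> S y -> S ((1 - t) *: x + t *: y).

Definition affine_hull S : set X := smallest affine_set S.

(* [within D F E] says that F-near points belong to E as soon as they are
   in D. *)
Definition ri S : set X :=
  [set x | affine_hull S x /\ within (affine_hull S) (nbhs x) S].

Definition nearly_equal S1 S2 : Prop :=
  closure S1 = closure S2 /\ ri S1 = ri S2.

End Sets.

Section Operators.
Context {R : realType} {X : euclideanType R}.

Definition operator := X -> set X.
Implicit Types A B : operator.

Definition dom A : set X := [set x | A x !=set0].
Definition ran A : set X := [set u | exists x, A x u].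
Definition gra A : set (X * X) := [set p | A p.1 p.2].

Definition op_id : operator := fun x => [set x].
Definition op_add A B : operator := fun x => set_add (A x) (B x).
Definition op_sub A B : operator := fun x => set_sub (A x) (B x).
Definition op_scale (a : R) A : operator := fun x => [set a *: u | u in A x].
Definition op_inv A : operator := fun u => [set x | A x u].
Definition op_comp B A : operator := fun x => \bigcup_(y in A x) B y.
Definition op_shift (w : X) B : operator := fun x => B (x - w).

Definition monotone_op A : Prop :=
  forall p q, gra A p -> gra A q -> 0 <= inner (p.1 - q.1) (p.2 - q.2).

Definition maximally_monotone A : Prop :=
  monotone_op A /\
  forall B, monotone_op B -> gra A `<=` gra B -> gra B = gra A.

Definition three_star_monotone A : Prop :=
  monotone_op A /\
  forall x v, dom A x -> ran A v ->
    (-oo < ereal_inf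
             [set (inner (x - p.1) (v - p.2))%:E | p in gra A])%E.

(* Resolvents are kept as set-valued operators; for a maximally monotone A,
   Minty's theorem makes every value of [resolvent A] a singleton. *)
Definition resolvent A : operator := op_inv (op_add op_id A).

Definition reflected_resolvent A : operator :=
  op_sub (op_scale 2 (resolvent A)) op_id.

Definition DouglasRachford A B : operator :=
  op_add (op_scale 2^-1 op_id)
         (op_scale 2^-1
            (op_comp (reflected_resolvent B) (reflected_resolvent A))).

End Operators.

Arguments operator {R} X.

(* Main.v *)
Require Import Defs.
From mathcomp Require Import all_boot all_order all_algebra.
From mathcomp Require Import all_classical all_reals all_analysis.
From mathcomp Require Import ring lra.

Import Order.TTheory GRing.Theory Num.Theory.
Import numFieldNormedType.Exports.

Local Open Scope classical_set_scope.
Local Open Scope ring_scope.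

(** Write [D] for [dom A - dom B], [R] for [ran A + ran B] and [E] for the
    range of [Id - T].  Unfolding the resolvents, [w] lies in [E] exactly when
    there are [u] in [A x] and [v] in [B y] with [x - y = w = u + v]; hence
    [E] is always contained in [D] intersected with [R], and [w] is in [E] as
    soon as it is in the range of [A + B_w].  The point is to obtain the
    converse inclusion on relative interiors,
    [ri D] intersected with [ri R] is contained in [E] (1).

    Under (i), inclusion (1) is immediate.  Under (ii) and (iii) it comes from
    [sum_range], which does in one step the work of Rockafellar's sum theorem
    and of the range theorem of Brezis and Haraux.  Fix [d] in [ri D] and [w] in [ri R],
    and look for a solution of [x - y = d], [u + v = w].  Adding the same
    error [- e (x + u)] to both equations yields a system which is solvable
    for every [e > 0]: it is the fixed point equation of a contraction built
    from the two reflected resolvents ([approximate_solution]), which are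
    everywhere defined by the theorem of Minty.  Monotonicity tested against
    graph points [(z, p)] of [A] and [(z', p')] of [B] gives an upper bound,
    uniform in [e], for
    [e |x + u|^2 + <u, z - z' - d> + <x, p + p' - w>].
    Since [d] and [w] are relative interior points, this bounds the component
    of [u] parallel to the affine hull of [D] and that of [x] parallel to the
    affine hull of [R].  Maximality allows the orthogonal components to be
    removed, moving [x] and [y], and likewise [u] and [- v], by the same
    vector.  The modified solutions are bounded and their errors tend to 0,
    so any cluster point solves the exact system.  The hypotheses (ii) and
    (iii) enter only to produce, for each [p] and [p'], lower bounds at one
    [z] with [z' = z - d].

    It remains to pass from (1) to near equality.  Domains of maximally
    monotone operators are nearly convex in the sense that the relative
    interior of their convex hull is contained in them ([nearly_convex_dom]);
    near convexity passes to Minkowski differences, hence to [D] and, through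
    inverse operators, to [R].  By Minty's theorem [D - R] is the whole space,
    and averaging points with a suitable difference shows that [ri D] meets
    [ri R].  Therefore [ri D] and [ri R] intersect in the relative interior of
    the intersection of [D] and [R], which is dense in that intersection, and
    any set squeezed between the two is nearly equal to both.  Finally, a full
    domain of [A] or [B] makes [D] the whole space and a full range makes [R]
    the whole space, which gives (a) and (b). *)

(** * Inner products *)

Set Implicit Arguments.
Unset Strict Implicit.
Unset Printing Implicit Defensive.

Section Inner.
Context {R : realType} {X : euclideanType R}.
Implicit Types (x y z : X) (a : R).

Lemma innerDl x y z : inner (x + y) z = inner x z + inner y z :> R.
Proof. by rewrite linearDl. Qed.
Lemma innerDr x y z : inner x (y + z) = inner x y + inner x z :> R.
Proof. by rewrite linearDr. Qed.
Lemma innerZl a x y : inner (a *: x) y = a * inner x y :> R.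
Proof. by rewrite linearZl_LR. Qed.
Lemma innerZr a x y : inner x (a *: y) = a * inner x y :> R.
Proof. by rewrite linearZr_LR. Qed.
Lemma innerNl x y : inner (- x) y = - inner x y :> R.
Proof. by rewrite linearNl. Qed.
Lemma innerNr x y : inner x (- y) = - inner x y :> R.
Proof. by rewrite linearNr. Qed.
Lemma inner0l x : inner 0 x = 0 :> R.
Proof. by rewrite linear0l. Qed.
Lemma inner0r x : inner x 0 = 0 :> R.
Proof. by rewrite linear0r. Qed.
Lemma innerC x y : inner x y = inner y x :> R.
Proof. by rewrite hermC expr0 mul1r. Qed.

Definition innerE := (innerDl, innerDr, innerNl, innerNr, innerZl, innerZr).

(** Vector identities can be tested against every [z], where they become ring
    identities in the scalars [inner _ z]. *)
Lemma inner_inj x y : (forall z, inner x z = inner y z :> R) -> x = y.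
Proof.
move=> xy; apply/eqP; rewrite -subr_eq0 -normr_eq0 -sqrf_eq0 normr_inner.
by rewrite innerDl innerNl xy subrr.
Qed.

Lemma inner_ge0 x : 0 <= inner x x :> R.
Proof. by rewrite -normr_inner exprn_ge0. Qed.

Lemma inner_young x y : inner x y <= inner x x + inner y y / 4 :> R.
Proof.
have := inner_ge0 (x - 2^-1 *: y); rewrite !innerE (innerC y x); lra.
Qed.

Lemma cauchy_schwarz x y : `|inner x y| <= `|x| * `|y|.
Proof.
rewrite -ler_sqr ?nnegrE ?mulr_ge0 // exprMn !normr_inner real_normK ?num_real//.
have [->|y0] := eqVneq y 0; first by rewrite !inner0r expr0n mulr0.
have yy : 0 < inner y y :> R.
  by rewrite -normr_inner exprn_gt0 // normr_gt0.
have := inner_ge0 (inner y y *: x - inner x y *: y).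
rewrite !innerE (innerC y x) => h.
have : 0 <= inner y y * (inner x x * inner y y - inner x y ^+ 2) :> R by lra.
by rewrite pmulr_rge0 // subr_ge0.
Qed.

End Inner.

Ltac vector_ring := apply: inner_inj => ?; rewrite !innerE; ring.

(** * Orthonormal sequences, projections and cluster points *)

Section Orthonormal.
Context {R : realType} {X : euclideanType R}.
Implicit Types (x y z v : X) (e : seq X).

Fixpoint orthonormal_seq e : Prop :=
  if e is v :: e' then
    [/\ `|v| = 1, forall y, y \in e' -> inner v y = 0 :> R & orthonormal_seq e']
  else True.

Definition orth_proj e x : X := \sum_(y <- e) inner x y *: y.

Lemma inner_suml (I : Type) (s : seq I) (F : I -> X) y :
  inner (\sum_(i <- s) F i) y = \sum_(i <- s) inner (F i) y :> R.
Proof.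
elim: s => [|i s IH]; first by rewrite !big_nil inner0l.
by rewrite !big_cons innerDl IH.
Qed.

Lemma inner_proj_eq0 e v x :
  (forall y, y \in e -> inner v y = 0 :> R) -> inner (orth_proj e x) v = 0 :> R.
Proof.
move=> ve; rewrite inner_suml big1_seq// => y /= ye.
by rewrite innerZl (innerC y) ve ?mulr0.
Qed.

Lemma inner_proj e x y :
  orthonormal_seq e -> y \in e -> inner (orth_proj e x) y = inner x y :> R.
Proof.
elim: e => // v e IH [v1 ve one].
rewrite /orth_proj big_cons -/(orth_proj e x) innerDl innerZl inE => /orP[/eqP->|ye].
  by rewrite inner_proj_eq0// -normr_inner v1 expr1n mulr1 addr0.
by rewrite ve// mulr0 add0r IH.
Qed.

Lemma orthonormal_cons e v : orthonormal_seq e -> v != 0 ->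
  (forall y, y \in e -> inner v y = 0 :> R) ->
  orthonormal_seq (`|v|^-1 *: v :: e).
Proof.
move=> one v0 ve; split=> // [|y ye]; last by rewrite innerZl ve ?mulr0.
by rewrite normrZ normfV normr_id mulVf ?normr_eq0.
Qed.

Lemma orthonormal_free e : orthonormal_seq e -> free e.
Proof.
elim: e => [_|v e IH [v1 ve one]]; first by rewrite nil_free.
rewrite free_cons IH// andbT; apply/negP => vin.
have : inner v v = 0 :> R.
  rewrite {1}(@coord_span _ _ _ (in_tuple e) _ vin) inner_suml big1_seq// => i _.
  by rewrite innerZl (innerC _ v) ve ?mulr0// mem_nth.
by move/eqP; rewrite -normr_inner v1 expr1n oner_eq0.
Qed.

Lemma size_orthonormal e : orthonormal_seq e -> (size e <= \dim {:X})%N.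
Proof.
by move=> /orthonormal_free; rewrite /free => /eqP <-; rewrite dimvS ?subvf.
Qed.

(** Orthonormal sequences are free, so their length is bounded by the dimension
    of the space: any property of the empty sequence is shared by an orthonormal
    sequence that cannot be prolonged. *)
Lemma maximal_orthonormal (P : seq X -> Prop) : P [::] ->
  exists e, [/\ orthonormal_seq e, P e &
    forall v, orthonormal_seq (v :: e) -> ~ P (v :: e)].
Proof.
move=> P0; pose Q n := `[< exists e, [/\ orthonormal_seq e, P e & size e = n] >].
have exQ : exists n, Q n by exists 0%N; apply/asboolP; exists [::].
have leQ n : Q n -> (n <= \dim {:X})%N.
  by move=> /asboolP[e [one _ <-]]; exact: size_orthonormal.
case: (ex_maxnP exQ leQ) => n /asboolP[e [one Pe sz]] maxn.
exists e; split=> // v onve Pve.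
have /maxn : Q n.+1 by apply/asboolP; exists (v :: e); rewrite /= sz.
by rewrite ltnn.
Qed.

Definition linear_set (L : set X) : Prop :=
  L 0 /\ forall (a : R) x y, L x -> L y -> L (a *: x + y).

Lemma linear_setZ L (a : R) x : linear_set L -> L x -> L (a *: x).
Proof. by move=> [L0 LL] Lx; rewrite -[_ *: _]addr0; exact: LL. Qed.

Lemma linear_setD L x y : linear_set L -> L x -> L y -> L (x + y).
Proof. by move=> [_ LL] Lx Ly; rewrite -[x]scale1r; exact: LL. Qed.

Lemma linear_setB L x y : linear_set L -> L x -> L y -> L (x - y).
Proof.
by move=> lL Lx Ly; rewrite -scaleN1r; apply: linear_setD => //; exact: linear_setZ.
Qed.

Lemma linear_set_proj L e x : linear_set L ->
  (forall y, y \in e -> L y) -> L (orth_proj e x).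
Proof.
move=> lL; elim: e => [|v e IH] Le; first by rewrite /orth_proj big_nil; case: lL.
rewrite /orth_proj big_cons; apply: linear_setD => //.
  by apply: linear_setZ => //; apply: Le; rewrite inE eqxx.
by apply: IH => y ye; apply: Le; rewrite inE ye orbT.
Qed.

(** A maximal orthonormal sequence in [L] spans [L]: otherwise the normalized
    residual of a vector outside the span would prolong it. *)
Lemma orthonormal_basis L : linear_set L -> exists e,
  [/\ orthonormal_seq e, forall y, y \in e -> L y & forall x, L x -> orth_proj e x = x].
Proof.
move=> lL.
have [//|e [one Le maxe]] := maximal_orthonormal (P := fun e => forall y, y \in e -> L y).
exists e; split=> // x Lx; apply/eqP/negPn/negP => ex.
have nv : x - orth_proj e x != 0 by rewrite subr_eq0 eq_sym.
have/maxe [] : orthonormal_seq (`|x - orth_proj e x|^-1 *: (x - orth_proj e x) :: e).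
  apply: orthonormal_cons => // y ye.
  by rewrite innerDl innerNl inner_proj// subrr.
move=> y; rewrite inE => /orP[/eqP->|/Le//].
by apply: linear_setZ => //; apply: linear_setB => //; exact: linear_set_proj.
Qed.

Lemma projD e x y : orth_proj e (x + y) = orth_proj e x + orth_proj e y.
Proof.
by rewrite /orth_proj -big_split; apply: eq_bigr => v _; rewrite innerDl scalerDl.
Qed.

Lemma projZ e (t : R) x : orth_proj e (t *: x) = t *: orth_proj e x.
Proof.
by rewrite /orth_proj scaler_sumr; apply: eq_bigr => v _; rewrite innerZl scalerA.
Qed.

Lemma proj_idem e x : orthonormal_seq e -> orth_proj e (orth_proj e x) = orth_proj e x.
Proof.
by move=> one; apply: eq_big_seq => v ve; rewrite inner_proj.
Qed.

Lemma inner_residual e x y :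
  orthonormal_seq e -> orth_proj e y = y -> inner (x - orth_proj e x) y = 0 :> R.
Proof.
move=> one <-; rewrite innerC inner_proj_eq0// => v ve.
by rewrite innerDl innerNl inner_proj// subrr.
Qed.

Lemma proj_bounded (I : Type) e (u : I -> X) :
  (forall y, y \in e -> exists c : R, forall n, `|inner (u n) y| <= c) ->
  exists M : R, forall n, `|orth_proj e (u n)| <= M.
Proof.
elim: e => [_|v e IH bnd]; first by exists 0 => n; rewrite /orth_proj big_nil normr0.
have [|M uM] := IH; first by move=> y ye; apply: bnd; rewrite inE ye orbT.
have [c uc] := bnd v (mem_head _ _).
exists (c * `|v| + M) => n; rewrite /orth_proj big_cons.
apply: le_trans (ler_normD _ _) _; apply: lerD; last exact: uM.
by rewrite normrZ ler_wpM2r.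
Qed.

(** Coordinates in an orthonormal basis are bounded reals, which converge along
    any ultrafilter by compactness of segments. *)
Lemma ultra_bounded_cvg (U : set_system nat) (u : nat -> X) (M : R) :
  UltraFilter U -> (forall n, `|u n| <= M) -> exists l : X, u @ U --> l.
Proof.
move=> uU uM.
have [|e [one _ projT]] := @orthonormal_basis setT; first by [].
have cvg_coord y : exists l : R, (fun n => inner (u n) y : R) @ U --> l.
  set f := fun n => inner (u n) y : R.
  have fI : U [set n | `[- (M * `|y|), M * `|y|]%classic (f n)].
    apply: filterE => n /=; rewrite in_itv/= -ler_norml.
    by apply: le_trans (cauchy_schwarz _ _) _; rewrite ler_wpM2r.
  have ufU : UltraFilter (f @ U).
    split; first exact: fmap_proper_filter.
    move=> G pG FG; apply/seteqP; split => // A GA.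
    have [//|/(FG (~` A)) GA'] := in_ultra_setVsetC (f @^-1` A) uU.
    have [t []] // := filter_ex (filterI GA GA').
  have := @segment_compact R (- (M * `|y|)) (M * `|y|).
  by rewrite compact_ultra => /(_ _ ufU fI)[l [_ fl]]; exists l.
have {cvg_coord}/choice[l lP] := cvg_coord.
exists (\sum_(y <- e) l y *: y).
rewrite (_ : u = fun n => \sum_(y <- e) inner (u n) y *: y); last first.
  by apply/funext => n; rewrite -[LHS]projT.
apply: cvg_big => //; first exact: add_continuous.
by move=> y _; apply: cvgZ => //; exact: cvg_cst.
Qed.

(** A common cluster point is found along one ultrafilter finer than the
    filter of cofinite sets, which avoids extracting subsequences twice. *)
Lemma cluster_pair (u v : nat -> X) (M N : R) :
  (forall n, `|u n| <= M) -> (forall n, `|v n| <= N) ->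
  exists l l' : X, forall (r : R) (m : nat), 0 < r ->
    exists n, [/\ (m <= n)%N, `|u n - l| < r & `|v n - l'| < r].
Proof.
move=> uM vN; have [U [uU ooU]] := @ultraFilterLemma nat \oo _.
have [l ul] := ultra_bounded_cvg uU uM.
have [l' vl'] := ultra_bounded_cvg uU vN.
exists l, l' => r m r0.
have h1 : U [set n | (m <= n)%N] by apply: ooU; exists m.
have h2 : U [set n | `|u n - l| < r].
  by move/cvgrPdistC_lt : ul => /(_ _ r0).
have h3 : U [set n | `|v n - l'| < r].
  by move/cvgrPdistC_lt : vl' => /(_ _ r0).
by have [n [[? ?] ?]] := filter_ex (filterI (filterI h1 h2) h3); exists n.
Qed.

End Orthonormal.

(** * Convex hulls and maximal monotonicity *)

Section Convex.
Context {R : realType}.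

Definition convex_subset {V : lmodType R} (S : set V) : Prop :=
  forall x y (t : R), 0 <= t -> t <= 1 -> S x -> S y ->
    S ((1 - t) *: x + t *: y).

Definition convex_hull {V : lmodType R} (S : set V) : set V :=
  smallest convex_subset S.

Lemma convex_hull_convex {V : lmodType R} (S : set V) :
  convex_subset (convex_hull S).
Proof.
move=> x y t t0 t1 Sx Sy C CP; case: (CP) => cC _.
by apply: cC => //; [exact: (Sx C)|exact: (Sy C)].
Qed.

Lemma sub_convex_hull {V : lmodType R} (S : set V) : S `<=` convex_hull S.
Proof. exact: sub_smallest. Qed.

Lemma convex_hull_min {V : lmodType R} (S C : set V) :
  convex_subset C -> S `<=` C -> convex_hull S `<=` C.
Proof. exact: smallest_sub. Qed.

End Convex.

Section Monotone.
Context {R : realType} {X : euclideanType R}.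
Implicit Types (A B : operator X) (x y z u v w p a : X).

Definition monotone_related A x u : Prop :=
  forall z p, A z p -> 0 <= inner (x - z) (u - p) :> R.

Lemma monotone_opP A :
  monotone_op A <-> forall x u, A x u -> monotone_related A x u.
Proof.
by split=> mA => [x u Axu z p Azp|[x u] [z p] Axu Azp];
  [exact: (mA (x, u) (z, p))|exact: mA].
Qed.

(** Maximality says that every pair related to the whole graph belongs to it:
    adding such a pair to the graph keeps it monotone. *)
Lemma maximally_monotoneP A : maximally_monotone A <->
  (forall x u, A x u <-> monotone_related A x u).
Proof.
split=> [[/monotone_opP mA maxA] x u|AP]; last first.
  split=> [|B mB AB]; first by apply/monotone_opP => x u /AP.
  apply/seteqP; split => // -[x u] Bxu; apply/AP => z p Azp.
  by apply: (mB (x, u) (z, p)) => //; exact: AB.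
split=> [|rel]; first exact: mA.
pose B : operator X := fun y => [set v | A y v \/ (y = x /\ v = u)].
suff BA : gra B = gra A by have : gra B (x, u) by [right]; rewrite BA.
apply: maxA => [|[y v] ?]; last by left.
move=> [y v] [z p]; rewrite /gra /B /= => -[Ayv|[-> ->]] [Azp|[-> ->]].
- exact: mA.
- by rewrite -opprB -(opprB u) innerNl innerNr opprK; exact: rel.
- exact: rel.
- by rewrite subrr inner0l.
Qed.

(** Translations, rescalings, inverses and reflections of an operator all act
    on its graph by a surjection that multiplies the monotonicity form by a
    positive constant. *)
Lemma maximally_monotone_transport A B (f g : X -> X -> X * X) (c : R) :
  0 < c -> (forall x u, f (g x u).1 (g x u).2 = (x, u)) ->
  (forall x u z p, inner ((f x u).1 - (f z p).1) ((f x u).2 - (f z p).2) =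
      c * inner (x - z) (u - p) :> R) ->
  (forall x u, B x u <-> A (f x u).1 (f x u).2) ->
  maximally_monotone A -> maximally_monotone B.
Proof.
move=> c0 gK fE BA /maximally_monotoneP AP; apply/maximally_monotoneP => x u.
rewrite BA AP; split=> rel z p.
  by rewrite BA => /rel; rewrite fE pmulr_rge0.
move=> Azp; have := rel (g z p).1 (g z p).2; rewrite BA gK => /(_ Azp).
by rewrite -(pmulr_rge0 _ c0) -fE gK.
Qed.

Lemma inner_ge0_limit x u z p :
  (forall r : R, 0 < r -> exists x' u', [/\ `|x' - x| < r, `|u' - u| < r &
     - r <= inner (x' - z) (u' - p)]) ->
  0 <= inner (x - z) (u - p) :> R.
Proof.
move=> lim; rewrite leNgt; apply/negP => neg.
set nu := - inner (x - z) (u - p) : R.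
have nu0 : 0 < nu by rewrite /nu oppr_gt0.
set S := `|u - p| + `|x - z| + 2.
have S0 : 0 < S by rewrite /S; have := normr_ge0 (u - p); have := normr_ge0 (x - z); lra.
have d0 : 0 < nu + S by rewrite addr_gt0.
pose r := nu / (nu + S).
have r0 : 0 < r by rewrite divr_gt0.
have r1 : r <= 1 by rewrite ler_pdivrMr// mul1r lerDl ltW.
have rS : r * S < nu.
  by rewrite /r mulrAC ltr_pdivrMr// ltr_pM2l// ltrDr.
have [x' [u' [xx' uu' low]]] := lim r r0.
have E : inner (x' - z) (u' - p) =
    - nu + (inner (x' - x) (u' - p) + inner (x - z) (u' - u)) :> R.
  by rewrite /nu !innerE; ring.
have h1 : inner (x' - x) (u' - p) <= r * (`|u - p| + 1) :> R.
  apply: le_trans (ler_norm _) _; apply: le_trans (cauchy_schwarz _ _) _.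
  apply: ler_pM => //; first exact: ltW.
  rewrite -[u' - p](subrKA u) addrC.
  by apply: le_trans (ler_normD _ _) _; rewrite lerD2l (le_trans (ltW uu')).
have h2 : inner (x - z) (u' - u) <= r * `|x - z| :> R.
  apply: le_trans (ler_norm _) _; apply: le_trans (cauchy_schwarz _ _) _.
  by rewrite mulrC ler_wpM2r// ltW.
move: low; rewrite E; move: rS; rewrite /S; lra.
Qed.

Lemma maximally_monotone_closed A x u : maximally_monotone A ->
  (forall r : R, 0 < r -> exists x' u', [/\ `|x' - x| < r, `|u' - u| < r & A x' u']) ->
  A x u.
Proof.
move=> /maximally_monotoneP AP lim; apply/AP => z p Azp.
apply: inner_ge0_limit => r r0; have [x' [u' [? ? /AP rel]]] := lim r r0.
exists x', u'; split=> //; apply: le_trans (rel _ _ Azp).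
by rewrite oppr_le0 ltW.
Qed.

(** The points [(x, u, <x, u>)], which index the affine functions whose
    supremum is the Fitzpatrick function of [A]. *)
Definition lifted_graph A : set (X * X * R^o)%type :=
  [set t | A t.1.1 t.1.2 /\ t.2 = inner t.1.1 t.1.2].

(** Monotonicity reads [c + c' - <z, p'> - <z', p> >= 0] for any two points
    [(z, p, c)] and [(z', p', c')] of the lifted graph.  This expression is
    affine in each point separately, so the inequality extends to the convex
    hull in one point and then in the other; the claim is the diagonal case. *)
Lemma lifted_graph_hull A (t : (X * X * R^o)%type) : monotone_op A ->
  convex_hull (lifted_graph A) t -> inner t.1.1 t.1.2 <= t.2 :> R.
Proof.
move=> /monotone_opP mA Mt.
have half (z p : X) : A z p ->
    0 <= t.2 + inner z p - inner t.1.1 p - inner z t.1.2 :> R.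
  move=> Azp; move: t Mt; apply: convex_hull_min => /=.
    move=> [[x u] b] [[y v] c] s s0 s1 /= h1 h2.
    rewrite !innerE -[_ *: b]/(_ * b) -[_ *: c]/(_ * c).
    have : 0 <= (1 - s) * (b + inner z p - inner x p - inner z u) +
        s * (c + inner z p - inner y p - inner z v) :> R.
      by apply: addr_ge0; apply: mulr_ge0 => //; rewrite subr_ge0.
    lra.
  move=> [[x u] b]; rewrite /lifted_graph /= => -[Axu ->]; have := mA _ _ Axu _ _ Azp.
  by rewrite !innerE; lra.
have : 0 <= t.2 + t.2 - inner t.1.1 t.1.2 - inner t.1.1 t.1.2 :> R.
  have : forall t' : (X * X * R^o)%type, convex_hull (lifted_graph A) t' ->
      0 <= t.2 + t'.2 - inner t.1.1 t'.1.2 - inner t'.1.1 t.1.2 :> R.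
    apply: convex_hull_min => /=.
      move=> [[x u] b] [[y v] c] s s0 s1 /= h1 h2.
      rewrite !innerE -[_ *: b]/(_ * b) -[_ *: c]/(_ * c).
      have : 0 <= (1 - s) * (t.2 + b - inner t.1.1 u - inner x t.1.2) +
          s * (t.2 + c - inner t.1.1 v - inner y t.1.2) :> R.
        by apply: addr_ge0; apply: mulr_ge0 => //; rewrite subr_ge0.
      lra.
    by move=> [[z p] b]; rewrite /lifted_graph /= => -[Azp ->]; exact: half.
  exact.
lra.
Qed.

End Monotone.

(** * Minty's theorem *)

Section Minty.
Context {R : realType} {X : euclideanType R}.
Implicit Types (A B : operator X) (x y z u v w p a : X).

Lemma maximally_monotone_nonempty A : maximally_monotone A -> exists z p, A z p.
Proof.
move=> /maximally_monotoneP AP; apply: contrapT => nA.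
apply: (nA); exists 0, 0; apply/AP => z p Azp.
by exfalso; apply: nA; exists z, p.
Qed.

Lemma invS_gt0 n : 0 < n.+1%:R^-1 :> R. Proof. by rewrite invr_gt0. Qed.

Lemma invS_le1 n : n.+1%:R^-1 <= 1 :> R.
Proof. by rewrite invf_le1// ler1n. Qed.

Lemma small_invS (r : R) : 0 < r -> exists m, forall n, (m <= n)%N -> n.+1%:R^-1 < r.
Proof.
move=> r0; exists (Num.truncn r^-1) => n mn.
rewrite invf_plt ?posrE//; apply: lt_le_trans (truncnS_gt _) _.
by rewrite ler_nat.
Qed.

Let scale_regE (c : R) (b : R^o) : c *: b = c * b :> R. Proof. by []. Qed.

Let normD_half (s d : X) : `|(1 - 2^-1) *: s + 2^-1 *: d| ^+ 2 =
  (`|s| ^+ 2 + `|d| ^+ 2) / 2 - `|s - d| ^+ 2 / 4.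
Proof. by rewrite !normr_inner !innerE (innerC d s); field. Qed.

(** On the convex hull of the lifted graph, the function
    [h (z, p, c) = |p - z|^2 / 4 + c] is bounded below by [|p + z|^2 / 4], hence
    nonnegative.  Along a minimizing sequence, set [a = - (p - z) / 2]; the
    first order optimality condition in the direction of a graph point [(z, p)]
    says that [<a - z, a + p>] is nonpositive up to a vanishing error.  A cluster
    point [a] then makes [(a, - a)] monotonically related to the graph. *)
Lemma minty0 A : maximally_monotone A -> exists a, A a (- a).
Proof.
move=> maxA; have [/[dup] monoA mA _] := maxA.
have [z0 [p0 A0]] := maximally_monotone_nonempty maxA.
pose M := convex_hull (lifted_graph A).
pose q (t : (X * X * R^o)%type) : X := t.1.2 - t.1.1.
pose h (t : (X * X * R^o)%type) : R := `|q t| ^+ 2 / 4 + t.2.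
have h0 t : M t -> 0 <= h t.
  move=> /(lifted_graph_hull mA); rewrite /h /q normr_inner.
  have := inner_ge0 (t.1.2 + t.1.1).
  by rewrite !innerE (innerC t.1.2 t.1.1); lra.
have Mz : M (z0, p0, inner z0 p0 : R) by apply: sub_convex_hull.
have hM : has_inf (h @` M).
  split; first by exists (h (z0, p0, inner z0 p0 : R)), (z0, p0, inner z0 p0 : R).
  by exists 0 => _ [t Mt <-]; exact: h0.
set m := inf (h @` M).
have hm t : M t -> m <= h t by move=> Mt; apply: ge_inf; [case: hM|exists t].
have m0 : 0 <= m by apply: lb_le_inf; [case: hM|move=> _ [t Mt <-]; exact: h0].
have /choice[t tP] : forall n : nat, exists t, M t /\ h t < m + n.+1%:R^-1 ^+ 2.
  move=> n.
  have [||_ [s Ms <-] hs] := @inf_adherent _ (h @` M) (n.+1%:R^-1 ^+ 2); last by exists s.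
  - by rewrite exprn_gt0// invS_gt0.
  - exact: hM.
have q_conv (e : R) s t' : q ((1 - e) *: s + e *: t') = (1 - e) *: q s + e *: q t'.
  by rewrite /q /= !scalerBr opprD addrACA.
(* By the parallelogram law and convexity of the hull, two points that nearly
   minimize [h] have close [q]. *)
have q_bounded n : `|q (t n)| <= `|q (t 0%N)| + 4.
  have [Mn hn] := tP n; have [M0 ht0] := tP 0%N.
  have half0 : 0 <= 2^-1 :> R by lra.
  have half1 : 2^-1 <= 1 :> R by lra.
  have hmid := hm _ (convex_hull_convex half0 half1 Mn M0).
  have n1 : n.+1%:R^-1 ^+ 2 <= 1 :> R by rewrite exprn_ile1// ?invS_le1// ltW// invS_gt0.
  have {n1}hn : h (t n) < m + 1 by apply: lt_le_trans hn _; rewrite lerD2l.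
  rewrite invr1 expr1n in ht0.
  suff d4 : `|q (t n) - q (t 0%N)| <= 4.
    rewrite -[q (t n)](subrK (q (t 0%N))) addrC.
    by apply: le_trans (ler_normD _ _) _; rewrite lerD2l.
  rewrite -ler_sqr ?nnegrE//.
  move: hn ht0 hmid; rewrite /h q_conv normD_half /= !scale_regE.
  move: (`|_| ^+ 2 : R) (`|q (t n)| ^+ 2 : R) (`|q (t 0%N)| ^+ 2 : R).
  move: ((t n).2 : R) ((t 0%N).2 : R) (m : R); clear.
  by move=> *; lra.
pose a n : X := - 2^-1 *: q (t n).
(* The segment from the almost minimizer [t n] to the graph point is followed
   for a time [n.+1%:R^-1], whose square is the defect of [t n]. *)
have key n z p : A z p -> inner (a n - z) (a n + p) <=
    n.+1%:R^-1 * (1 + `|(p - z) - q (t n)| ^+ 2 / 4) :> R.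
  move=> Azp; have [Mn hn] := tP n.
  have e0 := invS_gt0 n; have e1 := invS_le1 n.
  have Mzp : M (z, p, inner z p : R) by apply: sub_convex_hull.
  have := hm _ (convex_hull_convex (ltW e0) e1 Mn Mzp).
  have := h0 _ Mn; move: hn; rewrite /a.
  move: e0; move: (n.+1%:R^-1 : R) => e e0 hn.
  rewrite /h q_conv {1}/q /= !scale_regE.
  set x := (t n).1.1; set u := (t n).1.2; set b : R := (t n).2.
  move: hn; rewrite /h /q -/x -/u -/b.
  move: (u - x) => s; rewrite !normr_inner.
  have := innerC (p - z) s; move E : (p - z) => d ds.
  have -> : inner (- 2^-1 *: s - z) (- 2^-1 *: s + p) =
     4^-1 * inner s s - 2^-1 * inner s d - inner z p :> R.
    by rewrite -E !innerE (innerC z s); field.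
  rewrite !innerE ds; set ss := inner s s : R; set sd := inner s d : R.
  set dd := inner d d : R; set c := inner z p : R => hn hpos hmin.
  rewrite -subr_ge0 -(pmulr_rge0 _ e0).
  have : 0 <= e * (ss / 4 + b) by rewrite mulr_ge0// ltW.
  lra.
have aM n : `|a n| <= 2^-1 * (`|q (t 0%N)| + 4).
  by rewrite normrZ normrN ger0_norm ?ler_pM2l.
have [l [l' lP]] := cluster_pair aM aM.
exists l; move/maximally_monotoneP : (maxA) => AP; apply/AP => z p Azp.
apply: inner_ge0_limit => r r0.
pose K := 1 + (`|p - z| + `|q (t 0%N)| + 4) ^+ 2 / 4.
have K0 : 0 < K by rewrite ltr_pwDl// mulr_ge0// sqr_ge0.
have [n0 n0P] := small_invS (divr_gt0 r0 K0).
have [n [/n0P n0n an _]] := lP r n0 r0.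
exists (a n), (- a n); split => //; first by rewrite -opprD normrN.
rewrite -opprD innerNr lerN2; apply: le_trans (key n _ _ Azp) _.
apply: le_trans (_ : n.+1%:R^-1 * K <= r); last by rewrite -ler_pdivlMr// ltW.
rewrite ler_pM2l ?invS_gt0// lerD2l ler_pM2r// ler_sqr ?nnegrE//.
apply: le_trans (ler_normB _ _) _; rewrite -addrA lerD2l; exact: q_bounded.
Qed.

(** The previous case applied to [A - x]. *)
Lemma minty A x : maximally_monotone A -> exists a, A a (x - a).
Proof.
move=> maxA; pose B : operator X := fun z p => A z (p + x).
have maxB : maximally_monotone B.
  apply: (@maximally_monotone_transport _ _ A B (fun z p => (z, p + x))
    (fun z p => (z, p - x)) 1) => //= [z p|z p z' p'].
    by rewrite subrK.
  by rewrite mul1r opprD addrACA subrr addr0.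
by have [a] := minty0 maxB; rewrite /B addrC; exists a.
Qed.

End Minty.

(** * The regularized inclusion *)

Section Approximation.
Context {R : realType} {X : euclideanType R}.
Implicit Types (A B : operator X) (x y z u v w p a d s : X).

(** The Picard iterates from 0 stay bounded and their increments vanish, so any
    cluster point is fixed. *)
Lemma contraction_fixed_point (N : X -> X) (c : R) : 0 <= c < 1 ->
  (forall x y, `|N x - N y| <= `|x - y|) -> exists s, s = c *: N s.
Proof.
move=> /andP[c0 c1] nexp; pose F x := c *: N x.
have FL x y : `|F x - F y| <= c * `|x - y|.
  by rewrite /F -scalerBr normrZ ger0_norm// ler_wpM2l.
pose s n := iter n F 0.
have b0 : 0 <= `|F 0| / (1 - c) by rewrite divr_ge0// subr_ge0 ltW.
have sb n : `|s n| <= `|F 0| / (1 - c).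
  elim: n => [|n IH] /=; first by rewrite normr0.
  rewrite -[F (iter n F 0)](subrK (F 0)).
  apply: le_trans (ler_normD _ _) _.
  have := FL (s n) 0; rewrite subr0 => h.
  have : c * `|s n| <= c * (`|F 0| / (1 - c)) by rewrite ler_wpM2l.
  have : c * (`|F 0| / (1 - c)) + `|F 0| = `|F 0| / (1 - c).
    by field; rewrite gt_eqF// subr_gt0.
  rewrite /s in h *; lra.
have sd n : `|s n - F (s n)| <= c ^+ n * `|F 0|.
  elim: n => [|n IH]; first by rewrite expr0 mul1r sub0r normrN.
  by rewrite exprS -mulrA; apply: le_trans (FL _ _) _; rewrite ler_wpM2l.
have [l [l' lP]] := cluster_pair sb sb.
exists l; apply/eqP; rewrite -subr_eq0 -normr_eq0; apply/eqP/le_anti.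
rewrite normr_ge0 andbT; apply/ler_addgt0Pl => e e0; rewrite addr0.
have e3 : 0 < e / 3 by rewrite divr_gt0.
have cvg0 : (fun n => c ^+ n * `|F 0|) @ \oo --> (0 : R).
  rewrite -[X in _ --> X](mul0r `|F 0|); apply: cvgM; last exact: cvg_cst.
  by apply: cvg_expr; rewrite ger0_norm.
move/cvgrPdist_lt : cvg0 => /(_ _ e3)[m _ mP].
have [n [mn nl _]] := lP _ m e3.
have := mP n mn; rewrite /= sub0r normrN ger0_norm ?mulr_ge0 ?exprn_ge0// => small.
have -> : l - F l = (l - s n) + ((s n - F (s n)) + (F (s n) - F l)).
  by rewrite !subrKA.
apply: le_trans (ler_normD _ _) _.
have h1 : `|l - s n| < e / 3 by rewrite distrC.
have h2 : `|s n - F (s n) + (F (s n) - F l)| <= e / 3 + e / 3.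
  apply: le_trans (ler_normD _ _) _; apply: lerD.
    by apply: le_trans (sd _) _; exact: ltW.
  apply: le_trans (FL _ _) _; apply: le_trans (ltW nl).
  by rewrite ler_piMl// ltW.
lra.
Qed.

Lemma resolvent_reflection_nonexpansive A (J : X -> X) :
  monotone_op A -> (forall x, A (J x) (x - J x)) ->
  forall x y, `|(2 *: J x - x) - (2 *: J y - y)| <= `|x - y|.
Proof.
move=> /monotone_opP mA JA x y; rewrite -ler_sqr ?nnegrE//.
have -> : 2 *: J x - x - (2 *: J y - y) = 2 *: (J x - J y) - (x - y) by vector_ring.
have := mA _ _ (JA x) _ _ (JA y).
have -> : x - J x - (y - J y) = (x - y) - (J x - J y) by vector_ring.
move: (J x - J y) (x - y) => a b; rewrite !normr_inner !innerE (innerC b a); lra.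
Qed.

(** With [C = B (. - d) - w] and [R_A], [R_C] the reflected resolvents, a fixed
    point [s = c R_C (R_A s)] yields [x = J_A s], [u = s - x], [y = J_C (R_A s)]
    and [v = R_A s - y], for which [x - y = u + v = - ((1 - c) / (2 c)) s].  The
    choice [c = (1 + 2 e)^-1] makes the last coefficient equal to [- e]. *)
Lemma approximate_solution A B d w (e : R) : 0 < e ->
  maximally_monotone A -> maximally_monotone B ->
  exists x u y v, [/\ A x u, B y v,
    x - y = d - e *: (x + u) & u + v = w - e *: (x + u)].
Proof.
move=> e0 maxA maxB.
pose C : operator X := fun y v => B (y - d) (v + w).
have maxC : maximally_monotone C.
  apply: (@maximally_monotone_transport _ _ B C (fun y v => (y - d, v + w))
    (fun y v => (y + d, v - w)) 1) => //= [y v|y v y' v'].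
    by rewrite subrK addrK.
  by rewrite mul1r; congr (inner _ _); vector_ring.
have /choice[JA JAP] := fun s => minty s maxA.
have /choice[JC JCP] := fun s => minty s maxC.
pose c := (1 + 2 * e)^-1.
have c01 : 0 <= c < 1.
  rewrite invr_ge0 addr_ge0 ?mulr_ge0 ?ltW//= invf_lt1; last first.
    by rewrite addr_gt0// mulr_gt0.
  by rewrite ltrDl mulr_gt0.
have nA := resolvent_reflection_nonexpansive (proj1 maxA) JAP.
have nC := resolvent_reflection_nonexpansive (proj1 maxC) JCP.
have [s sP] := contraction_fixed_point c01
  (fun x y => le_trans (nC (2 *: JA x - x) (2 *: JA y - y)) (nA x y)).
set x := JA s; set r := 2 *: x - s in sP; set y := JC r in sP.
have c0 : c != 0 by rewrite invr_eq0 gt_eqF// addr_gt0// mulr_gt0.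
have s_eq : x - y = - (e *: s).
  have : c^-1 *: s = 2 *: y - 2 *: x + s.
    rewrite {1}sP scalerA mulVf// scale1r; vector_ring.
  rewrite invrK => /(congr1 (fun v => 2^-1 *: v)) E.
  apply: inner_inj => z; have := congr1 (fun v => inner v z : R) E.
  by rewrite !innerE; lra.
exists x, (s - x), (y - d), (r - y + w); split.
- exact: JAP.
- exact: (JCP r).
- rewrite (_ : x - (y - d) = d + (x - y)); last by vector_ring.
  by rewrite s_eq; congr (_ - _ *: _); vector_ring.
- rewrite (_ : _ + _ = w + (x - y)); last by rewrite /r; vector_ring.
  by rewrite s_eq; congr (_ - _ *: _); vector_ring.
Qed.

End Approximation.

(** * Relative interiors and near convexity *)

Section RelativeInterior.
Context {R : realType} {X : euclideanType R}.
Implicit Types (S K : set X) (x y z u v w p a d q : X).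

Lemma affine_hull_affine S : affine_set (affine_hull S).
Proof.
move=> x y t Sx Sy C CP; case: (CP) => cC _.
by apply: cC; [exact: (Sx C)|exact: (Sy C)].
Qed.

Lemma sub_affine_hull S : S `<=` affine_hull S.
Proof. exact: sub_smallest. Qed.

Lemma affine_hull_min S K : affine_set K -> S `<=` K -> affine_hull S `<=` K.
Proof. exact: smallest_sub. Qed.

Lemma affine_hull_eq S K : S `<=` K -> K `<=` affine_hull S ->
  affine_hull K = affine_hull S.
Proof.
move=> SK KS; apply/seteqP; split.
  by apply: affine_hull_min => //; exact: affine_hull_affine.
apply: affine_hull_min; first exact: affine_hull_affine.
by apply: subset_trans (@sub_affine_hull K).
Qed.

Lemma convex_hull_sub_affine S : convex_hull S `<=` affine_hull S.
Proof.
apply: convex_hull_min; last exact: sub_affine_hull.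
by move=> x y t _ _; exact: affine_hull_affine.
Qed.

Lemma affine_hull_convex_hull S : affine_hull (convex_hull S) = affine_hull S.
Proof.
by apply: affine_hull_eq; [exact: sub_convex_hull|exact: convex_hull_sub_affine].
Qed.

(** For [q] in the affine hull of [S], the linear subspace parallel to it. *)
Definition direction S q : set X := [set v | affine_hull S (q + v)].

Lemma direction_linear S q : affine_hull S q -> linear_set (direction S q).
Proof.
move=> Sq; have affS := @affine_hull_affine S.
have scal (t : R) v : direction S q v -> direction S q (t *: v).
  rewrite /direction /= => Sv; rewrite (_ : _ + _ = (1 - t) *: q + t *: (q + v)).
    exact: affS.
  by vector_ring.
split=> [|t v v' /scal Sv Sv']; first by rewrite /direction /= addr0.
rewrite /direction /= (_ : q + _ = (1 - 2) *: q +
    2 *: ((1 - 2^-1) *: (q + t *: v) + 2^-1 *: (q + v'))).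
  by do 2![apply: (affS) => //]; exact: (Sv t).
by apply: inner_inj => z; rewrite !innerE; field.
Qed.

Lemma directionB S q x y : affine_hull S q -> affine_hull S x ->
  affine_hull S y -> direction S q (x - y).
Proof.
move=> Sq Sx Sy; rewrite (_ : x - y = (x - q) - (y - q)); last by vector_ring.
apply: (linear_setB (direction_linear Sq)); by rewrite /direction /= addrC subrK.
Qed.

Lemma riP S q : ri S q <-> affine_hull S q /\
  exists2 r : R, 0 < r & forall y, affine_hull S y -> `|y - q| < r -> S y.
Proof.
split=> -[Sq].
  rewrite /within /= => /nbhs_ballP[r /= r0 rS]; split=> //; exists r => // y Sy yq.
  by apply: rS => //; rewrite -ball_normE /= distrC.
move=> [r r0 rS]; split=> //; rewrite /within /=; apply/nbhs_ballP; exists r => //= y.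
by rewrite -ball_normE /= distrC => ? ?; exact: rS.
Qed.

Lemma ri_sub S : ri S `<=` S.
Proof. by move=> q /riP[Sq [r r0]]; apply => //; rewrite subrr normr0. Qed.

(** A relative interior point can be moved a little in every direction parallel
    to the affine hull; this is all that the bounds on approximate solutions
    use. *)
Lemma ri_radial S q v : ri S q -> direction S q v ->
  exists t : R, [/\ 0 < t, t <= 1 & S (q + t *: v)].
Proof.
move=> /riP[Sq [r r0 rS]] Sv.
have v0 : 0 <= `|v| by [].
have d0 : 0 < `|v| + r + r by lra.
have t0 : 0 < r / (`|v| + r + r) by rewrite divr_gt0.
exists (r / (`|v| + r + r)); split => //.
  by rewrite ler_pdivrMr// mul1r; lra.
apply: rS; first exact: (linear_setZ _ (direction_linear Sq)).
rewrite addrC addKr normrZ gtr0_norm// mulrAC ltr_pdivrMr// ltr_pM2l//.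
lra.
Qed.

Lemma ri_subset S K : S `<=` K -> K `<=` affine_hull S -> ri S `<=` ri K.
Proof.
move=> SK KS q /riP[Sq [r r0 rS]]; apply/riP; rewrite (affine_hull_eq SK KS).
by split=> //; exists r => // y Sy yq; apply: SK; exact: rS.
Qed.

Lemma ri_open S q : ri S q ->
  exists2 r : R, 0 < r & forall y, affine_hull S y -> `|y - q| < r -> ri S y.
Proof.
move=> /riP[Sq [r r0 rS]]; exists (r / 2); first by rewrite divr_gt0.
move=> y Sy yq; apply/riP; split=> //; exists (r / 2); first by rewrite divr_gt0.
move=> z Sz zy; apply: rS => //; rewrite -(subrKA y).
by apply: le_lt_trans (ler_normD _ _) _; lra.
Qed.

Lemma ri_idem S q : ri S q -> affine_hull (ri S) = affine_hull S.
Proof.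
move=> Sq; apply/esym/affine_hull_eq; first exact: ri_sub.
move=> y Sy; have [Aq _] := Sq.
have [r r0 rS] := ri_open Sq.
have affri : affine_hull (ri S) q by apply: sub_affine_hull.
have t0 : 0 < r / (`|y - q| + r) by rewrite divr_gt0// ltr_wpDl.
set t := r / _ in t0.
have Stv : ri S (q + t *: (y - q)).
  apply: rS.
    rewrite (_ : q + _ = (1 - t) *: q + t *: y); last by vector_ring.
    by apply: affine_hull_affine => //; exact: sub_affine_hull.
  rewrite addrC addKr normrZ gtr0_norm// mulrAC ltr_pdivrMr ?ltr_wpDl//.
  by rewrite ltr_pM2l// ltrDl.
rewrite (_ : y = (1 - t^-1) *: q + t^-1 *: (q + t *: (y - q))).
  by apply: affine_hull_affine => //; exact: sub_affine_hull.
by apply: inner_inj => z; rewrite !innerE; field; rewrite gt_eqF.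
Qed.

(** Points of [S] are limits of points of [ri S], so the closures agree; the
    affine hulls of [ri S] and [S] agree, so the relative interiors do too. *)
Lemma nearly_equal_between S E : (exists q, ri S q) -> S `<=` closure (ri S) ->
  ri S `<=` E -> E `<=` S -> nearly_equal E S.
Proof.
move=> [q Sq] Scl riE ES; split; apply/seteqP; split.
- exact: closure_subset.
- rewrite [X in X `<=` _]closureE; apply: smallest_sub.
    exact: closed_closure.
  apply: subset_trans Scl _; exact: closure_subset.
- apply: ri_subset => //; apply: subset_trans (@sub_affine_hull S) _.
  rewrite -(ri_idem Sq); apply: affine_hull_min; first exact: affine_hull_affine.
  by apply: subset_trans riE _; exact: sub_affine_hull.
- move=> y /[dup] /ri_open[r r0 rS] Sy; apply/riP.
  have EA : affine_hull E `<=` affine_hull S.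
    apply: affine_hull_min; first exact: affine_hull_affine.
    by apply: subset_trans ES _; exact: sub_affine_hull.
  split; first by apply: sub_affine_hull; exact: riE.
  by exists r => // z /EA Sz zy; apply: riE; exact: rS.
Qed.

(** The homothety of centre [y] and ratio [t] sends a relative ball around [q]
    to a relative ball around [(1 - t) y + t q]. *)
Lemma convex_ri_segment K q y (t : R) : convex_subset K -> ri K q -> K y ->
  0 < t -> t <= 1 -> ri K ((1 - t) *: y + t *: q).
Proof.
move=> cK /riP[Aq [r r0 rK]] Ky t0 t1; set p := _ + _.
have Ay : affine_hull K y by exact: sub_affine_hull.
have Ap : affine_hull K p by exact: affine_hull_affine.
apply/riP; split=> //; exists (t * r); first by rewrite mulr_gt0.
move=> z Az zp.
rewrite (_ : z = (1 - t) *: y + t *: (q + t^-1 *: (z - p))); last first.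
  by apply: inner_inj => s; rewrite !innerE; field; rewrite gt_eqF.
apply: cK => //; first exact: ltW.
apply: rK; first exact: (linear_setZ _ (direction_linear Aq) (directionB Aq Az Ap)).
by rewrite addrC addKr normrZ gtr0_norm ?invr_gt0// ltr_pdivrMl.
Qed.

(** Among the orthonormal sequences [e] such that [K] contains a ball, of some
    centre [c], of a translate of the span of [e], take a maximal one.  If some
    [y] in [K] left [c] plus the span of [e], the convex hull of that ball and
    [y] would contain a ball of one more dimension around the midpoint of [c]
    and [y].  So the affine hull of [K] is [c] plus the span, and [c] is in
    [ri K]. *)
Lemma convex_ri_nonempty K : convex_subset K -> K !=set0 -> ri K !=set0.
Proof.
move=> cK [k Kk].
pose P (e : seq X) := exists c (r : R), [/\ 0 < r, K c &
  forall w, orth_proj e w = w -> `|w| <= r -> K (c + w)].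
have [|e [one [c [r [r0 Kc disc]]] maxe]] := @maximal_orthonormal _ _ P.
  by exists k, 1; split=> // w; rewrite /orth_proj big_nil => <-; rewrite addr0.
have span y : K y -> orth_proj e (y - c) = y - c.
  move=> Ky; apply/eqP/negPn/negP => ney.
  set dy := y - c in ney *; set w0 := orth_proj e dy; pose n := dy - w0.
  have n0 : n != 0 by rewrite subr_eq0 eq_sym.
  have nn0 : 0 < `|n| by rewrite normr_gt0.
  have orth : orthonormal_seq (`|n|^-1 *: n :: e).
    apply: orthonormal_cons => // v ve.
    by rewrite innerDl innerNl inner_proj// subrr.
  apply: (maxe _ orth).
  have S0 : 0 < 2 + `|n|^-1 * `|w0|.
    by rewrite ltr_pwDl// mulr_ge0// invr_ge0.
  exists (c + 2^-1 *: dy), (Num.min (`|n| / 4) (r / 4 / (2 + `|n|^-1 * `|w0|))).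
  split.
  - by rewrite lt_min !divr_gt0.
  - rewrite (_ : c + _ = (1 - 2^-1) *: c + 2^-1 *: y).
      by apply: cK => //; lra.
    by rewrite /dy; vector_ring.
  move=> w; rewrite /orth_proj big_cons -/(orth_proj e w) le_min.
  set t : R := inner w _; set w1 := orth_proj e w => wE /andP[wn wr].
  (* With [n = y - c - w0], the component of [w] along [n] is [tau] times
     [y - c - w0]: the term [tau] shifts the weights of [c] and [y] away from
     one half, and [w1 - tau w0] is what remains to be absorbed by the ball
     around [c]. *)
  pose tau := t / `|n|.
  have tw : `|t| <= `|w|.
    apply: le_trans (cauchy_schwarz _ _) _.
    by rewrite normrZ normfV normr_id mulVf ?gt_eqF// mulr1.
  have taun : `|tau| <= `|w| * `|n|^-1.
    by rewrite /tau normrM normfV normr_id ler_pM2r ?invr_gt0.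
  have tau4 : `|tau| <= 4^-1.
    apply: le_trans taun _; rewrite ler_pdivrMr//.
    by rewrite mulrC.
  have w12 : `|w1| <= 2 * `|w|.
    rewrite (_ : w1 = w - t *: (`|n|^-1 *: n)); last by rewrite -{1}wE addrC addKr.
    apply: le_trans (ler_normB _ _) _.
    rewrite normrZ normrZ normfV normr_id mulVf ?gt_eqF// mulr1.
    lra.
  have /andP[tau_lo tau_hi] : - 4^-1 <= tau <= 4^-1 by rewrite -ler_norml.
  pose s := 2^-1 + tau.
  have s1 : 0 < 1 - s by rewrite /s; lra.
  rewrite (_ : c + _ + w =
      (1 - s) *: (c + (1 - s)^-1 *: (w1 - tau *: w0)) + s *: y).
    apply: cK => //; [rewrite /s; lra|rewrite /s; lra|].
    apply: disc.
      by rewrite projZ projD -scaleNr projZ !proj_idem.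
    rewrite normrZ gtr0_norm ?invr_gt0// ler_pdivrMl//.
    have h1 : `|w1 - tau *: w0| <= `|w| * (2 + `|n|^-1 * `|w0|).
      apply: le_trans (ler_normB _ _) _; rewrite mulrDr; apply: lerD.
        by rewrite mulrC.
      by rewrite normrZ mulrA ler_wpM2r.
    have h2 : `|w| * (2 + `|n|^-1 * `|w0|) <= r / 4 by rewrite -ler_pdivlMr.
    have h3 : 4^-1 * r <= (1 - s) * r by rewrite ler_pM2r// /s; lra.
    lra.
  rewrite -wE (_ : t *: _ = tau *: (dy - w0)); last first.
    by rewrite scalerA.
  rewrite /dy; apply: inner_inj => z; rewrite !innerE /s.
  by field; rewrite gt_eqF//; lra.
have affK y : affine_hull K y -> orth_proj e (y - c) = y - c.
  move: y; apply: affine_hull_min; last exact: span.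
  move=> x y t Ex Ey; rewrite (_ : _ - c = (1 - t) *: (x - c) + t *: (y - c)).
    by rewrite projD !projZ Ex Ey.
  by vector_ring.
exists c; apply/riP; split; first exact: sub_affine_hull.
exists r => // y /affK Ey yc; rewrite -[y](subrK c) addrC.
by apply: disc => //; exact: ltW.
Qed.

(** Equivalent, in finite dimension, to the existence of a convex set [C] such
    that [S] lies between [C] and its closure. *)
Definition nearly_convex S : Prop := ri (convex_hull S) `<=` S.

Lemma nearly_convex_ri S : nearly_convex S -> ri (convex_hull S) = ri S.
Proof.
move=> ncS; apply/seteqP; split; last first.
  by apply: ri_subset; [exact: sub_convex_hull|exact: convex_hull_sub_affine].
move=> q /[dup] /ncS Sq /ri_open[r r0]; rewrite affine_hull_convex_hull => rS.
apply/riP; split; first exact: sub_affine_hull.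
by exists r => // y Sy yq; apply: ncS; exact: rS.
Qed.

Lemma nearly_convex_segment S q y (t : R) : nearly_convex S -> ri S q -> S y ->
  0 < t -> t <= 1 -> ri S ((1 - t) *: y + t *: q).
Proof.
move=> ncS; rewrite -(nearly_convex_ri ncS) => Sq Sy; apply: convex_ri_segment => //.
  exact: convex_hull_convex.
exact: sub_convex_hull.
Qed.

Lemma nearly_convex_ri_nonempty S : nearly_convex S -> S !=set0 -> ri S !=set0.
Proof.
move=> ncS [x Sx]; rewrite -(nearly_convex_ri ncS).
apply: convex_ri_nonempty; first exact: convex_hull_convex.
by exists x; exact: sub_convex_hull.
Qed.

Lemma convex_hull_sub S1 S2 :
  convex_hull (set_sub S1 S2) `<=` set_sub (convex_hull S1) (convex_hull S2).
Proof.
apply: convex_hull_min; last first.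
  by move=> _ [x S1x] [y S2y] <-; exists x;
    [exact: sub_convex_hull|exists y => //; exact: sub_convex_hull].
move=> _ _ t t0 t1 [x Kx [y Ky <-]] [x' Kx' [y' Ky' <-]].
exists ((1 - t) *: x + t *: x'); first exact: convex_hull_convex.
exists ((1 - t) *: y + t *: y'); first exact: convex_hull_convex.
by vector_ring.
Qed.

Lemma sub_convex_hulls S1 S2 x y : convex_hull S1 x -> convex_hull S2 y ->
  convex_hull (set_sub S1 S2) (x - y).
Proof.
move=> Kx Ky; move: x Kx; apply: convex_hull_min => [x x' t t0 t1 /= Hx Hx'|x S1x /=].
  rewrite (_ : _ - y = (1 - t) *: (x - y) + t *: (x' - y)); last by vector_ring.
  exact: convex_hull_convex.
move: y Ky; apply: convex_hull_min => [y y' t t0 t1 /= Hy Hy'|y S2y /=].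
  rewrite (_ : x - _ = (1 - t) *: (x - y) + t *: (x - y')); last by vector_ring.
  exact: convex_hull_convex.
by apply: sub_convex_hull; exists x => //; exists y.
Qed.

(** Given [d] in the relative interior of the hull of [S1 - S2] and [a1], [a2]
    in the relative interiors of the hulls of [S1] and [S2], the point [d] can
    be pushed slightly away from [a1 - a2] to a difference [k1 - k2] of points of
    the hulls.  Then [d] is the difference of the same convex combination of
    [k1] and [a1] and of [k2] and [a2], which are relative interior points. *)
Lemma nearly_convex_sub S1 S2 : S1 !=set0 -> S2 !=set0 ->
  nearly_convex S1 -> nearly_convex S2 -> nearly_convex (set_sub S1 S2).
Proof.
move=> S1n S2n nc1 nc2 d Kd.
have [a1 ra1] := nearly_convex_ri_nonempty nc1 S1n.
have [a2 ra2] := nearly_convex_ri_nonempty nc2 S2n.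
have Ka : convex_hull (set_sub S1 S2) (a1 - a2).
  by apply: sub_convex_hulls; apply: sub_convex_hull; exact: ri_sub.
have Ad : affine_hull (convex_hull (set_sub S1 S2)) d.
  by apply: sub_affine_hull; exact: ri_sub.
have [t [t0 t1]] := ri_radial Kd (directionB Ad Ad (sub_affine_hull Ka)).
move=> /convex_hull_sub[k1 Kk1 [k2 Kk2 kE]].
have t10 : 0 < 1 + t by rewrite addr_gt0.
pose s := t / (1 + t).
have s0 : 0 < s by rewrite divr_gt0.
have s1 : s <= 1 by rewrite ler_pdivrMr// mul1r lerDr.
rewrite -(nearly_convex_ri nc1) in ra1; rewrite -(nearly_convex_ri nc2) in ra2.
have p1 := nc1 _ (convex_ri_segment (@convex_hull_convex _ _ S1) ra1 Kk1 s0 s1).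
have p2 := nc2 _ (convex_ri_segment (@convex_hull_convex _ _ S2) ra2 Kk2 s0 s1).
exists ((1 - s) *: k1 + s *: a1) => //; exists ((1 - s) *: k2 + s *: a2) => //.
rewrite (_ : _ - _ = (1 - s) *: (k1 - k2) + s *: (a1 - a2)); last by vector_ring.
by rewrite kE /s; apply: inner_inj => z; rewrite !innerE; field; rewrite gt_eqF.
Qed.

End RelativeInterior.

(** * Exact solutions at relative interior points *)

Section RangeOfSum.
Context {R : realType} {X : euclideanType R}.
Implicit Types (A B : operator X) (x y z u v w p d q k h : X) (e K : R).

(** Upper bounds on [<u n, s - q>] for [s] in [S] become two-sided bounds on
    [<u n, v>] for every direction [v], because [q] can be moved inside [S]
    towards both [v] and [- v]. *)
Lemma ri_direction_bounded (S : set X) q (u : nat -> X) : ri S q ->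
  (forall s, S s -> exists c : R, forall n, inner (u n) (s - q) <= c) ->
  forall v, direction S q v -> exists c : R, forall n, `|inner (u n) v| <= c.
Proof.
move=> Sq ub.
have half v : direction S q v -> exists c : R, forall n, inner (u n) v <= c.
  move=> /(ri_radial Sq)[t [t0 _ /ub[c uc]]]; exists (t^-1 * c) => n.
  rewrite ler_pdivlMl//; have := uc n.
  by rewrite (addrC q) addrK innerZr.
move=> v Lv; have [c uc] := half _ Lv.
have /half[c' uc'] : direction S q (-1 *: v).
  by apply: (linear_setZ _ (direction_linear _)) => //; case: Sq.
exists (Num.max c c') => n; rewrite ler_norml le_max uc andbT.
rewrite lerNl le_max; apply/orP; right.
by have := uc' n; rewrite scaleN1r innerNr.
Qed.

(** The resolvent of [e A] at a relative interior point [x0] of the hull gives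
    [x] and [u] in [A x] with [x + e u = x0].  Monotonicity bounds
    [<u, z - x0>] from above for [z] in the domain, hence in its hull, uniformly
    in [e <= 1].  As [u] is parallel to the affine hull, it is bounded; so [x]
    tends to [x0], and a cluster point of [u] belongs to [A x0]. *)
Lemma nearly_convex_dom A : maximally_monotone A -> nearly_convex (dom A).
Proof.
move=> maxA x0 x0ri.
have /choice[xu xuP] : forall n : nat, exists xu : X * X,
    A xu.1 xu.2 /\ x0 - xu.1 = n.+1%:R^-1 *: xu.2.
  move=> n; pose e : R := n.+1%:R^-1; have e0 : 0 < e by exact: invS_gt0.
  pose B : operator X := fun x u => A x (e^-1 *: u).
  have maxB : maximally_monotone B.
    apply: (@maximally_monotone_transport _ _ A B (fun x u => (x, e^-1 *: u))
      (fun x u => (x, e *: u)) e^-1) => //= [|x u|x u z p].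
    - by rewrite invr_gt0.
    - by rewrite scalerA mulVf ?scale1r// gt_eqF.
    - by rewrite -scalerBr innerZr.
  have [a Ba] := minty x0 maxB.
  exists (a, e^-1 *: (x0 - a)); split => //=.
  by rewrite scalerA mulfV ?scale1r// gt_eqF.
pose x n := (xu n).1; pose u n := (xu n).2.
have Axu n : A (x n) (u n) by case: (xuP n).
have xE n : x n = x0 - n.+1%:R^-1 *: u n.
  by case: (xuP n) => _ <-; rewrite subKr.
have Ax0 : affine_hull (convex_hull (dom A)) x0 by case: x0ri.
set L := direction (convex_hull (dom A)) x0.
have domL z : dom A z -> affine_hull (convex_hull (dom A)) z.
  by move=> Az; apply: sub_affine_hull; exact: sub_convex_hull.
have uL n : L (u n).
  have -> : u n = n.+1%:R *: (x0 - x n).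
    by rewrite xE subKr scalerA mulfV ?scale1r.
  apply: (linear_setZ _ (direction_linear Ax0)); apply: directionB => //.
  by apply: domL; exists (u n).
have bnd s : convex_hull (dom A) s -> exists c : R, forall n, inner (u n) (s - x0) <= c.
  move: s; apply: convex_hull_min => [s s' t t0 t1 [c uc] [c' uc']|z [p Azp]].
    exists ((1 - t) * c + t * c') => n.
    rewrite (_ : _ - x0 = (1 - t) *: (s - x0) + t *: (s' - x0)); last by vector_ring.
    by rewrite innerDr !innerZr; apply: lerD; apply: ler_wpM2l => //; rewrite subr_ge0.
  exists (inner p p / 4 + inner (z - x0) p) => n.
  have /monotone_opP mA := proj1 maxA; have := mA _ _ (Axu n) _ _ Azp.
  rewrite xE; have := invS_gt0 (R := R) n; have := invS_le1 (R := R) n.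
  move: (n.+1%:R^-1 : R) (u n) => e v e1 e0 mono.
  have : 0 <= e * (inner v v + inner p p / 4 - inner v p).
    by rewrite mulr_ge0 ?(ltW e0)// subr_ge0 inner_young.
  have : 0 <= (1 - e) * inner p p by rewrite mulr_ge0 ?inner_ge0// subr_ge0.
  move: mono; rewrite !innerE (innerC x0 v) (innerC z v).
  move: (inner v v : R) (inner p p : R) (inner v p : R) (inner v x0 : R)
    (inner v z : R) (inner z p : R) (inner x0 p : R); clear => *.
  lra.
have [b [onb bL bT]] := orthonormal_basis (direction_linear Ax0).
have [M uM] := proj_bounded (u := u) (fun y yb =>
  ri_direction_bounded x0ri bnd (bL y yb)).
have {}uM n : `|u n| <= M by rewrite -(bT _ (uL n)).
have [l [l' lP]] := cluster_pair uM uM.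
exists l; apply: (maximally_monotone_closed maxA) => r r0.
have M1 : 0 < M + 1 by rewrite ltr_wpDl// (le_trans _ (uM 0%N)).
have [m mP] := small_invS (divr_gt0 r0 M1).
have [n [/mP ne un _]] := lP r m r0.
exists (x n), (u n); split=> //.
rewrite xE addrAC subrr add0r normrN normrZ gtr0_norm ?invS_gt0//.
rewrite ltr_pdivlMr// in ne; apply: le_lt_trans ne.
rewrite ler_pM2l ?invS_gt0//; apply: le_trans (uM n) _; by rewrite lerDl.
Qed.

(** A translation orthogonal to [ran A - ran A] changes none of the products
    that express being monotonically related to the graph. *)
Lemma maximally_monotone_shiftl A x u k : maximally_monotone A -> A x u ->
  (forall p, ran A p -> inner k (u - p) = 0 :> R) -> A (x - k) u.
Proof.
move=> /maximally_monotoneP AP Axu orth; apply/AP => z p Azp.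
rewrite addrAC innerDl innerNl orth ?subr0; first exact: (AP x u).1.
by exists z.
Qed.

Lemma maximally_monotone_shiftr A x u k : maximally_monotone A -> A x u ->
  (forall z, dom A z -> inner k (x - z) = 0 :> R) -> A x (u - k).
Proof.
move=> /maximally_monotoneP AP Axu orth; apply/AP => z p Azp.
rewrite addrAC innerDr innerNr (innerC _ k) orth ?subr0; first exact: (AP x u).1.
by exists p.
Qed.

(** The sum of the two lower bounds, after elimination of [y], [v], [z'] and
    [p'], contains [<- e (x + u), x + u> - |e (x + u)|^2]; Young's inequality lets
    the square absorb the product of [e (x + u)] with the constant vector [c],
    so that the right-hand side is independent of [x], [u] and [e]. *)
Lemma approximate_solution_bound x u y v d w e z p z' p' K k h c : 0 < e ->
  k = z - z' - d -> h = p + p' - w -> c = h + k - p - z ->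
  x - y = d - e *: (x + u) -> u + v = w - e *: (x + u) ->
  - K <= inner (x - z) (u - p) -> - K <= inner (y - z') (v - p') ->
  e * inner (x + u) (x + u) + inner u k + inner x h <=
    2 * K + inner c c / 4 + inner p k + inner z h - inner k h.
Proof.
move=> e0 kE hE cE xy uv Kx Ky.
have yE : y = x - d + e *: (x + u).
  apply: inner_inj => s; have := congr1 (fun t => inner t s : R) xy.
  by rewrite !innerE; lra.
have vE : v = w - e *: (x + u) - u.
  apply: inner_inj => s; have := congr1 (fun t => inner t s : R) uv.
  by rewrite !innerE; lra.
set g := x + u in yE vE *.
have := inner_young (- (e *: g)) c.
have y1 : y - z' = (x - z) + e *: g + k by rewrite yE kE; vector_ring.
have v1 : v - p' = - (u - p) - e *: g - h by rewrite vE hE; vector_ring.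
move: Ky; rewrite y1 v1; move: Kx.
have gcE : inner g c = inner g h + inner g k - inner g p - inner g z :> R.
  by rewrite cE !innerE.
rewrite (innerNl (e *: g)) innerZl gcE.
move: (inner c c / 4 : R) => c4; clear -e0.
rewrite /g !innerE.
rewrite ?(innerC u x) ?(innerC z x) ?(innerC p x) ?(innerC k x) ?(innerC h x).
rewrite ?(innerC z u) ?(innerC p u) ?(innerC k u) ?(innerC h u).
rewrite ?(innerC p z) ?(innerC k z) ?(innerC h z).
rewrite ?(innerC k p) ?(innerC h p) ?(innerC h k).
lra.
Qed.

(** The condition that defines 3* monotonicity, at a single point [(z, p)]. *)
Definition rectangular_at A z p : Prop :=
  exists K, forall x u, A x u -> - K <= inner (x - z) (u - p).

Lemma rectangular_at_graph A z p : monotone_op A -> A z p -> rectangular_at A z p.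
Proof.
move=> /monotone_opP mA Azp; exists 0 => x u Axu; rewrite oppr0.
exact: mA.
Qed.

(** Testing with [z' = z - d] bounds [e |x + u|^2] and the products of [x] with
    directions of [ran A + ran B].  Once these are known, any pair of graph points
    bounds the products of [u] with directions of [dom A - dom B].  Projecting
    [x] and [u] onto these directions gives a bounded family of approximate
    solutions, with errors of norm [e |x + u|] tending to 0. *)
Lemma sum_range A B d w : maximally_monotone A -> maximally_monotone B ->
  ri (set_sub (dom A) (dom B)) d -> ri (set_add (ran A) (ran B)) w ->
  (forall p p', ran A p -> ran B p' ->
     exists z, rectangular_at A z p /\ rectangular_at B (z - d) p') ->
  exists x u, A x u /\ B (x - d) (w - u).
Proof.
move=> maxA maxB; set D := set_sub _ _; set W := set_add _ _ => Dd Ww rect.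
have /choice[s sP] : forall n : nat, exists s : (X * X) * (X * X),
  [/\ A s.1.1 s.1.2, B s.2.1 s.2.2,
     s.1.1 - s.2.1 = d - n.+1%:R^-1 *: (s.1.1 + s.1.2) &
     s.1.2 + s.2.2 = w - n.+1%:R^-1 *: (s.1.1 + s.1.2)].
  move=> n; have [x [u [y [v xuyv]]]] :=
    approximate_solution d w (invS_gt0 (R := R) n) maxA maxB.
  by exists ((x, u), (y, v)).
pose x n := (s n).1.1; pose u n := (s n).1.2.
pose y n := (s n).2.1; pose v n := (s n).2.2; pose g n := x n + u n.
have Axu n : A (x n) (u n) by case: (sP n).
have Byv n : B (y n) (v n) by case: (sP n).
have xyE n : x n - y n = d - n.+1%:R^-1 *: g n by case: (sP n).
have uvE n : u n + v n = w - n.+1%:R^-1 *: g n by case: (sP n).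
have est z p z' p' : rectangular_at A z p -> rectangular_at B z' p' ->
    exists c : R, forall n, n.+1%:R^-1 * inner (g n) (g n) +
      inner (u n) (z - z' - d) + inner (x n) (p + p' - w) <= c.
  move=> [K1 AK1] [K2 BK2]; pose K := Num.max K1 K2; eexists => n.
  apply: (approximate_solution_bound (K := K) (invS_gt0 n) erefl erefl erefl
    (xyE n) (uvE n)).
    by apply: le_trans (AK1 _ _ (Axu n)); rewrite lerN2 le_max lexx.
  by apply: le_trans (BK2 _ _ (Byv n)); rewrite lerN2 le_max lexx orbT.
have eg_ge0 n : 0 <= n.+1%:R^-1 * inner (g n) (g n) :> R.
  by rewrite mulr_ge0 ?inner_ge0// ltW// invS_gt0.
have estW q : W q -> exists c : R, forall n,
    n.+1%:R^-1 * inner (g n) (g n) + inner (x n) (q - w) <= c.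
  move=> [p Ap [p' Bp' <-]]; have [z [rA rB]] := rect _ _ Ap Bp'.
  have [c cP] := est _ _ _ _ rA rB; exists c => n; have := cP n.
  by rewrite subKr subrr inner0r addr0.
(* As [w] is itself a sum of points of the ranges, the choice [q = w] removes
   the product with [x]. *)
have [cg cgP] : exists c : R, forall n, n.+1%:R^-1 * inner (g n) (g n) <= c.
  have [c cP] := estW _ (ri_sub Ww); exists c => n; have := cP n.
  by rewrite subrr inner0r addr0.
have xW := ri_direction_bounded (u := x) Ww (fun q Wq =>
  let: ex_intro c cP := estW q Wq in
  ex_intro _ c (fun n => le_trans (ler_wpDl (eg_ge0 n) (lexx _)) (cP n))).
have [Ad _] := Dd; have [Aw _] := Ww.
have [[z0 Az0] [z0' Bz0']] : (dom A !=set0) /\ (dom B !=set0).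
  by have [z ? [z' ? _]] := ri_sub Dd; split; [exists z|exists z'].
have [[p0 Ap0] [p0' Bp0']] : (ran A !=set0) /\ (ran B !=set0).
  by have [z ? [z' ? _]] := ri_sub Ww; split; [exists z|exists z'].
have DA z z' : dom A z -> dom A z' -> direction D d (z - z').
  move=> Az Az'; rewrite (_ : z - z' = (z - z0') - (z' - z0')); last by vector_ring.
  by apply: directionB => //; apply: sub_affine_hull;
    [exists z => //|exists z' => //]; exists z0'.
have DB z z' : dom B z -> dom B z' -> direction D d (z - z').
  move=> Bz Bz'; rewrite (_ : z - z' = (z0 - z') - (z0 - z)); last by vector_ring.
  by apply: directionB => //; apply: sub_affine_hull;
    exists z0 => //; [exists z'|exists z].
have WA p p' : ran A p -> ran A p' -> direction W w (p - p').
  move=> Ap Ap'; rewrite (_ : p - p' = (p + p0') - (p' + p0')); last by vector_ring.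
  by apply: directionB => //; apply: sub_affine_hull;
    [exists p => //|exists p' => //]; exists p0'.
have WB p p' : ran B p -> ran B p' -> direction W w (p - p').
  move=> Bp Bp'; rewrite (_ : p - p' = (p0 + p) - (p0 + p')); last by vector_ring.
  by apply: directionB => //; apply: sub_affine_hull;
    exists p0 => //; [exists p|exists p'].
have uD : forall q, D q -> exists c : R, forall n, inner (u n) (q - d) <= c.
  move=> _ [z [p Azp] [z' [p' Bzp'] <-]].
  have [c cP] := est _ _ _ _ (rectangular_at_graph (proj1 maxA) Azp)
    (rectangular_at_graph (proj1 maxB) Bzp').
  have [|c' c'P] := xW (p + p' - w).
    rewrite /direction /= addrC subrK; apply: sub_affine_hull.
    by exists p; [exists z|exists p' => //; exists z'].
  exists (c + c') => n; have := cP n; have := eg_ge0 n; have := c'P n.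
  rewrite ler_norml => /andP[+ _].
  move: (n.+1%:R^-1 : R) => e lo pos tot.
  lra.
have [bW [onW bWL bWT]] := orthonormal_basis (direction_linear Aw).
have [bD [onD bDL bDT]] := orthonormal_basis (direction_linear Ad).
have [M xM] := proj_bounded (u := x) (fun q qb => xW q (bWL q qb)).
have [N uN] := proj_bounded (u := u) (fun q qb =>
  ri_direction_bounded Dd uD (bDL q qb)).
have [l [l' lP]] := cluster_pair xM uN.
pose kx n := x n - orth_proj bW (x n); pose ku n := u n - orth_proj bD (u n).
(* The residuals of [x] and [u] are orthogonal to all differences of points of
   the ranges, respectively of the domains, so both graphs stay invariant when
   [x] and [y] move by [kx] and when [u] and [v] move by [ku] in opposite
   directions; the differences [x - y] and the sums [u + v] are unchanged. *)
have A' n : A (x n - kx n) (u n - ku n).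
  have Ax' : A (x n - kx n) (u n).
    apply: maximally_monotone_shiftl => // p Ap.
    by apply: inner_residual => //; apply: bWT; apply: WA => //; exists (x n).
  apply: maximally_monotone_shiftr => // z Az.
  by apply: inner_residual => //; apply: bDT; apply: DA => //; exists (u n).
have B' n : B (y n - kx n) (v n - - ku n).
  have By' : B (y n - kx n) (v n).
    apply: maximally_monotone_shiftl => // p Bp.
    by apply: inner_residual => //; apply: bWT; apply: WB => //; exists (y n).
  apply: maximally_monotone_shiftr => // z Bz; rewrite innerNl.
  rewrite inner_residual ?oppr0//; apply: bDT; apply: DB => //.
  by exists (v n).
have small (r : R) : 0 < r -> exists m, forall n, (m <= n)%N -> `|n.+1%:R^-1 *: g n| < r.
  move=> r0; have c1 : 0 < cg + 1.
    by rewrite ltr_wpDl// (le_trans (eg_ge0 0%N)).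
  have [m mP] := small_invS (divr_gt0 (exprn_gt0 2 r0) c1).
  exists m => n /mP; rewrite ltr_pdivlMr// => ne.
  rewrite -ltr_sqr ?nnegrE ?(ltW r0)//; apply: le_lt_trans ne.
  rewrite normr_inner innerZl innerZr ler_pM2l ?invS_gt0//.
  by apply: le_trans (cgP n) _; rewrite lerDl.
exists l, l'; split.
  apply: maximally_monotone_closed maxA _ => r r0.
  have [n [_ xl ul]] := lP r 0%N r0.
  by exists (x n - kx n), (u n - ku n); split; rewrite // /kx /ku subKr.
apply: maximally_monotone_closed maxB _ => r r0.
have r2 : 0 < r / 2 by rewrite divr_gt0.
have [m mP] := small _ r2; have [n [/mP gn xl ul]] := lP _ m r2.
exists (y n - kx n), (v n - - ku n); split=> //.
  rewrite (_ : _ - _ = (orth_proj bW (x n) - l) + n.+1%:R^-1 *: g n).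
    by apply: le_lt_trans (ler_normD _ _) _; lra.
  apply: inner_inj => t; have := congr1 (fun a => inner a t : R) (xyE n).
  by rewrite /kx !innerE; move: (n.+1%:R^-1 : R) => e E; lra.
rewrite (_ : _ - _ = - ((orth_proj bD (u n) - l') + n.+1%:R^-1 *: g n)).
  by rewrite normrN; apply: le_lt_trans (ler_normD _ _) _; lra.
apply: inner_inj => t; have := congr1 (fun a => inner a t : R) (uvE n).
by rewrite /ku !innerE; move: (n.+1%:R^-1 : R) => e E; lra.
Qed.

End RangeOfSum.

(** * Intersections and the range of the displacement operator *)

Section Intersection.
Context {R : realType} {X : euclideanType R}.
Implicit Types (S : set X) (q y : X).

Lemma sub_ri_setI S1 S2 : ri S1 `&` ri S2 `<=` ri (S1 `&` S2).
Proof.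
move=> q [q1 q2]; apply/riP; split.
  by apply: sub_affine_hull; split; exact: ri_sub.
move: q1 q2 => /riP[_ [r1 r10 rS1]] /riP[_ [r2 r20 rS2]].
exists (Num.min r1 r2); first by rewrite lt_min r10.
move=> y Ay; rewrite lt_min => /andP[y1 y2]; split.
  apply: rS1 => //; move: Ay; apply: affine_hull_min; first exact: affine_hull_affine.
  by move=> x [Sx _]; exact: sub_affine_hull.
apply: rS2 => //; move: Ay; apply: affine_hull_min; first exact: affine_hull_affine.
by move=> x [_ Sx]; exact: sub_affine_hull.
Qed.

(** From a point of [ri (S1 `&` S2)], move slightly away from [q] inside the
    intersection: the point becomes interior to a segment ending at [q]. *)
Lemma ri_setI S1 S2 : nearly_convex S1 -> nearly_convex S2 ->
  ri S1 `&` ri S2 !=set0 -> ri (S1 `&` S2) = ri S1 `&` ri S2.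
Proof.
move=> nc1 nc2 [q [q1 q2]]; apply/seteqP; split; last exact: sub_ri_setI.
move=> y yri; have [Ay _] := yri.
have Aq : affine_hull (S1 `&` S2) q.
  by apply: sub_affine_hull; split; exact: ri_sub.
have [t [t0 _ [S1y S2y]]] := ri_radial yri (directionB Ay Ay Aq).
have t10 : 0 < 1 + t by rewrite addr_gt0.
have s0 : 0 < t / (1 + t) by rewrite divr_gt0.
have s1 : t / (1 + t) <= 1 by rewrite ler_pdivrMr// mul1r lerDr.
rewrite (_ : y = (1 - t / (1 + t)) *: (y + t *: (y - q)) + (t / (1 + t)) *: q).
  by split; exact: nearly_convex_segment.
by apply: inner_inj => z; rewrite !innerE; field; rewrite gt_eqF.
Qed.

Lemma nearly_convex_setI_closure S1 S2 : nearly_convex S1 -> nearly_convex S2 ->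
  ri S1 `&` ri S2 !=set0 -> S1 `&` S2 `<=` closure (ri (S1 `&` S2)).
Proof.
move=> nc1 nc2 [q [q1 q2]] y [S1y S2y] B /nbhs_ballP[r /= r0 rB].
have d0 : 0 < `|q - y| + r by rewrite ltr_wpDl.
pose t := r / (`|q - y| + r).
have t0 : 0 < t by rewrite divr_gt0.
have t1 : t <= 1 by rewrite ler_pdivrMr// mul1r lerDr.
exists ((1 - t) *: y + t *: q); split.
  by apply: sub_ri_setI; split; exact: nearly_convex_segment.
apply: rB; rewrite -ball_normE /= distrC.
rewrite (_ : _ - y = t *: (q - y)); last by vector_ring.
rewrite normrZ gtr0_norm// /t mulrAC ltr_pdivrMr// ltr_pM2l//.
by rewrite ltrDl.
Qed.

End Intersection.

Section DouglasRachfordRange.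
Context {R : realType} {X : euclideanType R}.
Implicit Types (A B : operator X) (w : X).

(** At [s], one has [x] in [J_A s], [u = s - x], [y] in [J_B (x - u)] and
    [v = x - u - y], and the displacement is [s - T s = x - y = u + v]. *)
Lemma ran_id_sub_DouglasRachford A B w :
  ran (op_sub op_id (DouglasRachford A B)) w <->
  exists x u, A x u /\ B (x - w) (w - u).
Proof.
split.
  move=> [s [_ -> [_ [_ [_ -> <-] [_ [z [_ [_ [x Ax <-] [_ -> <-]] Bz] <-] <-]] <-]]].
  move: Ax Bz => [_ -> [u Axu sE]] [_ [y By <-] [_ -> <-]].
  move: By => [_ -> [v Byv vE]].
  exists x, u; split=> //.
  have wE t : inner x t - inner y t =
      inner (s - (2^-1 *: s + 2^-1 *: (2 *: y - (2 *: x - s)))) t :> R.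
    by rewrite !innerE; field.
  have sE' t := congr1 (fun a => inner a t : R) sE.
  have vE' t := congr1 (fun a => inner a t : R) vE.
  set w' := s - _ in wE *.
  rewrite (_ : x - w' = y); last first.
    by apply: inner_inj => t; rewrite innerDl innerNl -wE; ring.
  rewrite (_ : w' - u = v)//.
  apply: inner_inj => t; rewrite innerDl innerNl -wE.
  by have := sE' t; have := vE' t; rewrite !innerE; lra.
move=> [x [u [Axu Bv]]]; exists (x + u).
set y := x - w in Bv; set v := w - u in Bv; set s := x + u.
exists s => //; exists (2^-1 *: s + 2^-1 *: (2 *: y - (2 *: x - s))); last first.
  by rewrite /y; apply: inner_inj => t; rewrite !innerE; field.
exists (2^-1 *: s); first by exists s.
exists (2^-1 *: (2 *: y - (2 *: x - s))) => //.
exists (2 *: y - (2 *: x - s)) => //; exists (2 *: x - s).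
  exists (2 *: x); first by exists x => //; exists x => //; exists u.
  by exists s.
exists (2 *: y); last by exists (2 *: x - s).
exists y => //; exists y => //; exists v => //.
by rewrite /s /v /y; vector_ring.
Qed.

(** Ranges are domains of inverses; the reflection [v |-> - B^-1 (- v)] has domain
    [- ran B] and turns the sum into a difference. *)
Lemma nearly_convex_ran_add A B : maximally_monotone A -> maximally_monotone B ->
  nearly_convex (set_add (ran A) (ran B)).
Proof.
move=> maxA maxB.
have maxA' : maximally_monotone (op_inv A).
  apply: (@maximally_monotone_transport _ _ A _ (fun u x => (x, u))
    (fun x u => (u, x)) 1) => //= u x v y.
  by rewrite mul1r innerC.
pose B' : operator X := fun v y => B (- y) (- v).
have maxB' : maximally_monotone B'.
  apply: (@maximally_monotone_transport _ _ B _ (fun v y => (- y, - v))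
    (fun y v => (- v, - y)) 1) => //= [y v|v y u x]; first by rewrite !opprK.
  by rewrite mul1r -!opprD innerNl innerNr opprK innerC.
have [x [u Axu]] := maximally_monotone_nonempty maxA.
have [y [v Byv]] := maximally_monotone_nonempty maxB.
rewrite (_ : set_add _ _ = set_sub (dom (op_inv A)) (dom B')).
  apply: nearly_convex_sub; [by exists u, x| |exact: nearly_convex_dom..].
  by exists (- v), (- y); rewrite /B' !opprK.
apply/seteqP; split=> [_ [p Ap [q [z Bzq] <-]]|_ [p Ap [q [z Bzq] <-]]].
  exists p => //; exists (- q); last by rewrite opprK.
  by exists (- z); rewrite /B' !opprK.
by exists p => //; exists (- q) => //; exists (- z).
Qed.

Lemma nearly_convex_dom_sub A B : maximally_monotone A -> maximally_monotone B ->
  nearly_convex (set_sub (dom A) (dom B)).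
Proof.
move=> maxA maxB.
have [x [u Axu]] := maximally_monotone_nonempty maxA.
have [y [v Byv]] := maximally_monotone_nonempty maxB.
by apply: nearly_convex_sub; [exists x, u|exists y, v|exact: nearly_convex_dom..].
Qed.

(** Pick relative interior points [a1] and [a2] of the two sets.  By Minty's
    theorem for [B], the sets contain points [k1] and [k2] with
    [k1 - k2 = a2 - a1]; then the midpoints of [k1], [a1] and of [k2], [a2]
    coincide. *)
Lemma ri_dom_sub_ran_add_meet A B : maximally_monotone A -> maximally_monotone B ->
  ri (set_sub (dom A) (dom B)) `&` ri (set_add (ran A) (ran B)) !=set0.
Proof.
move=> maxA maxB.
have [z [p Azp]] := maximally_monotone_nonempty maxA.
have [y [v Byv]] := maximally_monotone_nonempty maxB.
have ncD := nearly_convex_dom_sub maxA maxB.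
have ncR := nearly_convex_ran_add maxA maxB.
have [|a1 a1D] := nearly_convex_ri_nonempty ncD.
  by exists (z - y), z; [exists p|exists y => //; exists v].
have [|a2 a2R] := nearly_convex_ri_nonempty ncR.
  by exists (p + v), p; [exists z|exists v => //; exists y].
have [b Bb] := minty (z - p + (a1 - a2)) maxB.
set c := _ - b in Bb.
have half0 : 0 < 2^-1 :> R by lra.
have half1 : 2^-1 <= 1 :> R by lra.
have k1 : set_sub (dom A) (dom B) (z - b).
  by exists z; [exists p|exists b => //; exists c].
have k2 : set_add (ran A) (ran B) (p + c).
  by exists p; [exists z|exists c => //; exists b].
have s1 := nearly_convex_segment ncD a1D k1 half0 half1.
have s2 := nearly_convex_segment ncR a2R k2 half0 half1.
exists ((1 - 2^-1) *: (z - b) + 2^-1 *: a1); split=> //.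
rewrite (_ : _ + _ = (1 - 2^-1) *: (p + c) + 2^-1 *: a2)//.
by rewrite /c; apply: inner_inj => t; rewrite !innerE; field.
Qed.

Lemma three_star_rectangular_at A z p : three_star_monotone A ->
  dom A z -> ran A p -> rectangular_at A z p.
Proof.
move=> [_ A3] Az Ap; have := A3 _ _ Az Ap.
set S := (X in ereal_inf X) => infS.
have lbS x u : A x u -> (ereal_inf S <= (inner (x - z) (u - p))%:E)%E.
  move=> Axu; apply: ereal_inf_lbound; exists (x, u) => //=; congr (_%:E).
  by rewrite -(opprB x) -(opprB u) innerNl innerNr opprK.
exists (- fine (ereal_inf S)) => x u /lbS; rewrite opprK.
by case: (ereal_inf S) infS => [r|//|//] _; rewrite ?lee_fin ?leye_eq.
Qed.

End DouglasRachfordRange.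

Unset Implicit Arguments.

Theorem theorem5p2 (R : realType) (X : euclideanType R) (A B : operator X)
    (maxA : maximally_monotone A) (maxB : maximally_monotone B) :
  let D := set_sub (dom A) (dom B) in
  let Rg := set_add (ran A) (ran B) in
  let T := DouglasRachford A B in
  [\/ forall w, (ri D `&` ri Rg) w ->
        ri (set_add (ran A) (ran B)) `<=` ri (ran (op_add A (op_shift w B))),
      three_star_monotone A /\ three_star_monotone B
    | set_add (dom B) (ri D `&` ri Rg) `<=` dom A /\ three_star_monotone A] ->
  [/\ nearly_equal (ran (op_sub op_id T)) (D `&` Rg),
      (exists C, [/\ C = A \/ C = B, dom C = setT & three_star_monotone C]) ->
        nearly_equal (ran (op_sub op_id T)) Rg,
      (exists C, [/\ C = A \/ C = B, ran C = setT & three_star_monotone C]) ->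
        nearly_equal (ran (op_sub op_id T)) D
    & ri (D `&` Rg) = D `&` Rg -> ran (op_sub op_id T) = D `&` Rg].
Proof.
move=> D Rg T hyp; set E := ran (op_sub op_id T).
have ncD : nearly_convex D by exact: nearly_convex_dom_sub.
have ncR : nearly_convex Rg by exact: nearly_convex_ran_add.
have meet : ri D `&` ri Rg !=set0 by exact: ri_dom_sub_ran_add_meet.
have riE : ri (D `&` Rg) = ri D `&` ri Rg by exact: ri_setI.
have ED : E `<=` D `&` Rg.
  move=> w /ran_id_sub_DouglasRachford[x [u [Axu Bxu]]]; split.
    exists x; first by exists u.
    by exists (x - w); [exists (w - u)|rewrite subKr].
  exists u; first by exists x.
  by exists (w - u); [exists (x - w)|rewrite addrC subrK].
have DE : ri (D `&` Rg) `<=` E.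
  rewrite riE => w [Dw Rw]; apply/ran_id_sub_DouglasRachford.
  have [/(_ w (conj Dw Rw) w Rw)/ri_sub|[A3 B3]|[BA A3]] := hyp.
  - move=> [x [u Axu [v Bv wE]]]; exists x, u; split=> //.
    by rewrite -[X in X - u]wE addrAC subrr add0r.
  - apply: sum_range => // p p' Ap Bp'.
    have [z Az [z' Bz' wE]] := ri_sub Dw.
    exists z; split; first exact: three_star_rectangular_at.
    by apply: three_star_rectangular_at => //; rewrite -wE subKr.
  - apply: sum_range => // p p' Ap [z' Bz'p'].
    have Az : dom A (z' + w).
      by apply: BA; exists z'; [exists p'|exists w].
    exists (z' + w); rewrite addrK; split; first exact: three_star_rectangular_at.
    exact: (rectangular_at_graph (proj1 maxB)).
have near : nearly_equal E (D `&` Rg).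
  apply: nearly_equal_between => //; first by rewrite riE.
  exact: nearly_convex_setI_closure.
have [a [p Aap]] := maximally_monotone_nonempty maxA.
have [b [q Bbq]] := maximally_monotone_nonempty maxB.
split=> //.
- move=> [C [CAB domC _]]; rewrite -[Rg]setTI (_ : setT = D)//.
  apply/seteqP; split=> // d _; case: CAB domC => -> domC.
    exists (d + b); first by rewrite domC.
    by exists b; [exists q|rewrite addrK].
  exists a; first by exists p.
  by exists (a - d); [rewrite domC|rewrite subKr].
- move=> [C [CAB ranC _]]; rewrite -[D]setIT (_ : setT = Rg)//.
  apply/seteqP; split=> // d _; case: CAB ranC => -> ranC.
    exists (d - q); first by rewrite ranC.
    by exists q; [exists b|rewrite subrK].
  exists p; first by exists a.
  by exists (d - p); [rewrite ranC|rewrite addrC subrK].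
- by move=> riS; apply/seteqP; split=> //; rewrite -{1}riS.
Qed.
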